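(* Let $P$ be any finite set of prime numbers. Then there exists a function $f:\mathbb{N}\to\{-1,1\}$ which is $P$-multiplicative (i.e. $f(pn)=f(p)f(n)$ for every $p\in P$ and every $n\in\mathbb{N}$) and whose partial sums are bounded: there is a constant $C$ such that $\left|\sum_{n\le x} f(n)\right|\le C$ for all $x\ge 1$.
   Context: Here $\mathbb{N}=\{1,2,3,\dots\}$. No multiplicativity is required with respect to primes outside $P$; the values of $f$ at integers coprime to all primes in $P$ may be chosen freely. *)

(* Defs.v *)
From Stdlib Require Import ZArith Znumtheory List.
Open Scope Z_scope.

(* Partial sum  sum_{n=1}^{N} f n  (domain of f is N = {1,2,...}; f 0 unused). *)
Fixpoint psum (f : nat -> Z) (N : nat) : Z :=
  match N with
  | O => 0
  | S k => psum f k + f (S k)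
  end.

Definition P_multiplicative (P : list Z) (f : nat -> Z) : Prop :=
  forall p n : nat, In (Z.of_nat p) P -> (1 <= n)%nat ->
    f (p * n)%nat = f p * f n.

(* Main.v *)
(** Take f(pn) = f(n) for p in P and write D_d g(x) = g(x/d).  If F is the sum of f up
    to x and M the sum over the n prime to P, where f is free, then M = A F with
    A = prod (1 - D_p).  For J large B' = prod (1 - D_p^J) - 1 has a tiny Lipschitz norm,
    and S A = 1 + B' for the finite sum of dilations S = prod (1 + D_p + ... + D_p^(J-1)).
    Let s be a Lipschitz function within 1 of F, and let N be the solution of
    S N = B' s, i.e. N = A B' (1 + B')^-1 s.  It varies slowly, whatever the signs f,
    and N(x) depends only on the values f(n) with n <= x/2; so the free signs can be
    chosen greedily to keep M - N bounded.
    Then F = S (M - N) + B' (s - F) is bounded. *)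

Require Import Defs.
From Stdlib Require Import ZArith Znumtheory List.
From Stdlib Require Import Reals Lra Lia.
Open Scope Z_scope.

Local Open Scope R_scope.

Lemma Rabs_le_inv (x y : R) : Rabs x <= y -> - y <= x <= y.
Proof. assert (H1 := Rle_abs x). assert (H2 := Rle_abs (- x)). rewrite Rabs_Ropp in H2. lra. Qed.

(** * Floor of a nonnegative real *)

Definition flr (x : R) : nat := Z.to_nat (Int_part x).

Lemma flr_spec (x : R) : 0 <= x -> INR (flr x) <= x < INR (flr x) + 1.
Proof.
  intros Hx. unfold flr. destruct (base_Int_part x) as [H1 H2].
  assert (0 <= Int_part x)%Z.
  { assert (IZR (-1) < IZR (Int_part x)) by (simpl; lra).
    apply lt_IZR in H. lia. }
  rewrite INR_IZR_INZ, Z2Nat.id by assumption. lra.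
Qed.

Lemma flr_unique (x : R) (n : nat) : INR n <= x < INR n + 1 -> flr x = n.
Proof.
  intros H. assert (H0 := pos_INR n).
  destruct (flr_spec x) as [H1 H2]; [lra|].
  rewrite <- S_INR in H2. destruct H as [H3 H4]. rewrite <- S_INR in H4.
  assert (INR (flr x) < INR (S n)) as H5 by lra.
  assert (INR n < INR (S (flr x))) as H6 by lra.
  apply INR_lt in H5. apply INR_lt in H6. lia.
Qed.

Lemma flr_INR (n : nat) : flr (INR n) = n.
Proof. apply flr_unique; lra. Qed.

Lemma flr_le (x y : R) : 0 <= x <= y -> (flr x <= flr y)%nat.
Proof.
  intros H. destruct (flr_spec x), (flr_spec y); try lra.
  assert (INR (flr x) < INR (S (flr y))) as H4 by (rewrite S_INR; lra).
  apply INR_lt in H4. lia.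
Qed.

Lemma flr_div (x : R) (p : nat) : 0 <= x -> (1 <= p)%nat ->
  flr (x / INR p) = (flr x / p)%nat.
Proof.
  intros Hx Hp. apply flr_unique.
  assert (0 < INR p) by (apply lt_0_INR; lia).
  destruct (flr_spec x Hx) as [H1 H2].
  assert (H3 := Nat.div_mod_eq (flr x) p).
  assert (H4 := Nat.mod_upper_bound (flr x) p ltac:(lia)).
  set (q := (flr x / p)%nat) in *.
  assert (p * q <= flr x)%nat as H5 by lia.
  assert (S (flr x) <= p * q + p)%nat as H6 by lia.
  apply le_INR in H5, H6. rewrite S_INR, plus_INR in H6.
  rewrite mult_INR in H5, H6.
  assert (Hxe : x = (x / INR p) * INR p) by (field; lra).
  set (y := x / INR p) in *.
  split.
  - apply Rmult_le_reg_r with (INR p); lra.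
  - apply Rmult_lt_reg_r with (INR p); lra.
Qed.

(** * Finite sums and their dilations *)

Fixpoint rsum (a : nat -> R) (K : nat) : R :=
  match K with
  | O => 0
  | S k => rsum a k + a (S k)
  end.

Lemma rsum_ext (a b : nat -> R) (K : nat) :
  (forall n, (1 <= n <= K)%nat -> a n = b n) -> rsum a K = rsum b K.
Proof.
  induction K as [|K IH]; intros H; simpl; [reflexivity|].
  rewrite IH, H; [reflexivity|lia|intros; apply H; lia].
Qed.

Lemma rsum_minus (a b : nat -> R) (K : nat) :
  rsum (fun n => a n - b n) K = rsum a K - rsum b K.
Proof. induction K as [|K IH]; simpl; [lra|rewrite IH; lra]. Qed.

Lemma rsum_abs_le (a b : nat -> R) (K : nat) :
  (forall n, (1 <= n <= K)%nat -> Rabs (a n) <= b n) -> Rabs (rsum a K) <= rsum b K.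
Proof.
  induction K as [|K IH]; intros H; simpl.
  - rewrite Rabs_R0; lra.
  - eapply Rle_trans; [apply Rabs_triang|].
    apply Rplus_le_compat; [apply IH; intros; apply H; lia|apply H; lia].
Qed.

Lemma rsum_one (K : nat) : rsum (fun _ => 1) K = INR K.
Proof. induction K as [|K IH]; [reflexivity|rewrite S_INR; simpl; lra]. Qed.

Lemma rsum_extend (a : nat -> R) (K L : nat) : (K <= L)%nat ->
  (forall n, (K < n <= L)%nat -> a n = 0) -> rsum a L = rsum a K.
Proof.
  intros HKL. induction HKL as [|L HKL IH]; intros H; [reflexivity|].
  simpl. rewrite IH, (H (S L)); [lra|lia|intros; apply H; lia].
Qed.

(** The quotient [N / p] grows, by one, exactly when [N] reaches a multiple of [p]. So dilating a
    summatory function amounts to placing [a] on the multiples of [p]. *)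
Lemma rsum_dilate (a : nat -> R) (p N : nat) : (1 <= p)%nat ->
  rsum a (N / p)%nat =
  rsum (fun m => if (m mod p =? 0)%nat then a (m / p)%nat else 0) N.
Proof.
  intros Hp. induction N as [|N IH].
  - rewrite Nat.Div0.div_0_l. reflexivity.
  - cbn [rsum]. rewrite <- IH.
    assert (H1 := Nat.div_mod_eq N p).
    assert (H2 := Nat.mod_upper_bound N p ltac:(lia)).
    destruct (Nat.eqb_spec (S N mod p) 0) as [H|H].
    + assert (H3 := Nat.div_mod_eq (S N) p). rewrite H in H3.
      assert (S N / p = S (N / p))%nat as -> by nia.
      reflexivity.
    + assert (H3 := Nat.div_mod_eq (S N) p).
      assert (H4 := Nat.mod_upper_bound (S N) p ltac:(lia)).
      assert (S N / p = N / p)%nat as -> by nia.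
      lra.
Qed.

(** * Step and Lipschitz versions of the summatory function *)

Definition step_sum (a : nat -> R) (x : R) : R := rsum a (flr x).

Definition clamp (t : R) : R := Rmax 0 (Rmin 1 t).

(* Vanishing on [0, 1], unlike linear interpolation of the partial sums at the
   integers, makes iterated dilations eventually zero. *)
Definition ramp_sum (a : nat -> R) (x : R) : R :=
  rsum (fun n => a n * clamp (x - INR n)) (flr x).

Ltac minmax := unfold clamp, Rmax, Rmin in *; repeat destruct Rle_dec; try lra.

Lemma rsum_clamp (x : R) (K : nat) :
  rsum (fun n => clamp (x - INR n)) K = Rmax 0 (Rmin (INR K) (x - 1)).
Proof.
  induction K as [|K IH].
  - simpl. minmax.
  - cbn [rsum]. rewrite IH, S_INR. assert (H := pos_INR K). minmax.
Qed.

Lemma ramp_sum_extend (a : nat -> R) (x : R) (K : nat) : 0 <= x -> (flr x <= K)%nat ->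
  rsum (fun n => a n * clamp (x - INR n)) K = ramp_sum a x.
Proof.
  intros Hx HK. apply rsum_extend; [assumption|]. intros n Hn.
  destruct (flr_spec x Hx) as [_ H].
  assert (S (flr x) <= n)%nat as H1 by lia. apply le_INR in H1. rewrite S_INR in H1.
  replace (clamp (x - INR n)) with 0 by minmax. lra.
Qed.

(** The ramp of [n] rises only on the interval from [n] to [n + 1]. These intervals do not overlap,
    so between [x] and [y] all ramps together rise by at most [y - x]. *)
Lemma ramp_sum_lipschitz (a : nat -> R) (x y : R) :
  (forall n, Rabs (a n) <= 1) -> 0 <= x <= y ->
  Rabs (ramp_sum a y - ramp_sum a x) <= y - x.
Proof.
  intros Ha Hxy. assert (HK := flr_le x y Hxy).
  rewrite <- (ramp_sum_extend a x (flr y)) by (lra || assumption).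
  unfold ramp_sum at 1. rewrite <- rsum_minus.
  apply Rle_trans with
    (rsum (fun n => clamp (y - INR n) - clamp (x - INR n)) (flr y)).
  - apply rsum_abs_le. intros n _.
    rewrite <- Rmult_minus_distr_l, Rabs_mult.
    assert (0 <= clamp (y - INR n) - clamp (x - INR n)) by minmax.
    rewrite (Rabs_pos_eq (clamp _ - _)) by assumption.
    specialize (Ha n). nra.
  - rewrite rsum_minus, !rsum_clamp. assert (H := pos_INR (flr y)). minmax.
Qed.

(** Only the ramp of the last term [n = flr x] can still be incomplete at [x]. *)
Lemma ramp_sum_close (a : nat -> R) (x : R) :
  (forall n, Rabs (a n) <= 1) -> 0 <= x ->
  Rabs (ramp_sum a x - step_sum a x) <= 1.
Proof.
  intros Ha Hx. unfold ramp_sum, step_sum. rewrite Rabs_minus_sym, <- rsum_minus.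
  apply Rle_trans with (rsum (fun n => 1 - clamp (x - INR n)) (flr x)).
  - apply rsum_abs_le. intros n _.
    replace (a n - a n * clamp (x - INR n)) with (a n * (1 - clamp (x - INR n))) by ring.
    rewrite Rabs_mult.
    assert (0 <= 1 - clamp (x - INR n)) by minmax.
    rewrite (Rabs_pos_eq (1 - _)) by assumption.
    specialize (Ha n). nra.
  - rewrite rsum_minus, rsum_clamp, rsum_one. destruct (flr_spec x Hx).
    assert (H1 := pos_INR (flr x)). minmax.
Qed.

Lemma ramp_sum_small (a : nat -> R) (x : R) : 0 <= x <= 1 -> ramp_sum a x = 0.
Proof.
  intros Hx. unfold ramp_sum.
  rewrite (rsum_extend _ 0); [reflexivity|lia|]. intros n Hn.
  assert (1 <= n)%nat as H1 by lia. apply le_INR in H1. simpl in H1.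
  replace (clamp (x - INR n)) with 0 by minmax. lra.
Qed.

Lemma ramp_sum_ext (a b : nat -> R) (x : R) : 0 <= x ->
  (forall n, INR n <= x -> a n = b n) -> ramp_sum a x = ramp_sum b x.
Proof.
  intros Hx H. apply rsum_ext. intros n Hn. rewrite H; [reflexivity|].
  destruct (flr_spec x Hx). assert (INR n <= INR (flr x)) by (apply le_INR; lia). lra.
Qed.

(** * Dirichlet polynomials in dilations *)

(* A list [(c1, d1); (c2, d2); ...] encodes the Dirichlet polynomial
   [sum_i c_i D_{d_i}] in the dilations [D_d g x = g (x / d)]. *)
Fixpoint op (l : list (R * R)) (g : R -> R) (x : R) : R :=
  match l with
  | nil => 0
  | (c, d) :: l => c * g (x / d) + op l g x
  end.

Definition scale (c d : R) (l : list (R * R)) : list (R * R) :=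
  map (fun e => (c * fst e, d * snd e)) l.

Fixpoint mul (l m : list (R * R)) : list (R * R) :=
  match l with
  | nil => nil
  | (c, d) :: l => scale c d m ++ mul l m
  end.

Fixpoint weight (l : list (R * R)) : R :=
  match l with
  | nil => 0
  | (c, _) :: l => Rabs c + weight l
  end.

(** Bounds the factor by which Lipschitz constants grow, since [D_d] divides them by [d]; [weight]
    does the same for the supremum norm. A polynomial with large dilations may have tiny slope
    without small weight. *)
Fixpoint slope (l : list (R * R)) : R :=
  match l with
  | nil => 0
  | (c, d) :: l => Rabs c / d + slope l
  end.

Definition dil_ge (b : R) (l : list (R * R)) : Prop := Forall (fun e => b <= snd e) l.

Lemma dil_ge_mul (b : R) (l m : list (R * R)) :
  dil_ge 1 l -> dil_ge b m -> 1 <= b -> dil_ge b (mul l m).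
Proof.
  intros Hl Hm Hb. induction Hl as [|[c d] l Hd Hl IH]; simpl; [constructor|].
  apply Forall_app; split; [|exact IH].
  apply Forall_map. eapply Forall_impl; [|exact Hm]. simpl in *. intros; nra.
Qed.

Lemma dil_ge_weaken (b c : R) (l : list (R * R)) : dil_ge c l -> b <= c -> dil_ge b l.
Proof. intros H Hbc. eapply Forall_impl; [|exact H]. cbn; intros; lra. Qed.

Lemma op_app (l m : list (R * R)) (g : R -> R) (x : R) :
  op (l ++ m) g x = op l g x + op m g x.
Proof. induction l as [|[c d] l IH]; simpl; [lra|rewrite IH; lra]. Qed.

Lemma op_scale (c d : R) (l : list (R * R)) (g : R -> R) (x : R) :
  op (scale c d l) g x = c * op l g (x / d).
Proof.
  induction l as [|[c' d'] l IH]; simpl; [lra|]. fold (scale c d l). rewrite IH.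
  replace (x / (d * d')) with (x / d / d'); [lra|].
  unfold Rdiv. rewrite Rinv_mult. ring.
Qed.

Lemma op_mul (l m : list (R * R)) (g : R -> R) (x : R) :
  op (mul l m) g x = op l (op m g) x.
Proof.
  induction l as [|[c d] l IH]; simpl; [lra|].
  rewrite op_app, op_scale, IH; reflexivity.
Qed.

Lemma op_ext (l : list (R * R)) (g h : R -> R) (x : R) :
  (forall y, g y = h y) -> op l g x = op l h x.
Proof. intros H. induction l as [|[c d] l IH]; simpl; [lra|rewrite IH, H; lra]. Qed.

Lemma op_lin (l : list (R * R)) (g h : R -> R) (u v x : R) :
  op l (fun y => u * g y + v * h y) x = u * op l g x + v * op l h x.
Proof. induction l as [|[c d] l IH]; simpl; [lra|rewrite IH; lra]. Qed.

Lemma op_comm (l m : list (R * R)) (g : R -> R) (x : R) :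
  op l (op m g) x = op m (op l g) x.
Proof.
  revert x. induction l as [|[c d] l IH]; intros x; simpl.
  - induction m as [|[c' d'] m IHm]; simpl in *; lra.
  - rewrite IH.
    transitivity (op m (fun y => c * g (y / d) + 1 * op l g y) x).
    2:{ apply op_ext; intros; lra. }
    rewrite op_lin. rewrite Rmult_1_l. f_equal. f_equal.
    clear IH. induction m as [|[c' d'] m IHm]; simpl; [reflexivity|].
    rewrite IHm. f_equal. f_equal. f_equal. unfold Rdiv; ring.
Qed.

Lemma div_bounds (b d x : R) : 1 <= b -> b <= d -> 0 <= x -> 0 <= x / d <= x / b.
Proof.
  intros Hb Hd Hx. split.
  - apply Rmult_le_pos; [assumption|]. left; apply Rinv_0_lt_compat; lra.
  - apply Rmult_le_compat_l; [assumption|]. apply Rinv_le_contravar; lra.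
Qed.

(** Causality: with [b = 2] it makes the Neumann iterates stabilise and keeps the target at [n]
    independent of the signs beyond [n / 2]. *)
Lemma op_ext_below (b : R) (l : list (R * R)) (g h : R -> R) (x : R) :
  1 <= b -> dil_ge b l -> 0 <= x ->
  (forall y, 0 <= y <= x / b -> g y = h y) -> op l g x = op l h x.
Proof.
  intros Hb Hl Hx H. induction Hl as [|[c d] l Hd Hl IH]; simpl; [reflexivity|].
  rewrite IH, H; [reflexivity|]. apply div_bounds; assumption.
Qed.

Lemma op_zero_below (b : R) (l : list (R * R)) (g : R -> R) (x : R) :
  1 <= b -> dil_ge b l -> 0 <= x ->
  (forall y, 0 <= y <= x / b -> g y = 0) -> op l g x = 0.
Proof.
  intros Hb Hl Hx H. rewrite (op_ext_below b l g (fun _ => 0)) by assumption.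
  clear. induction l as [|[c d] l IH]; simpl; lra.
Qed.

Lemma op_bounded (l : list (R * R)) (g : R -> R) (C x : R) : dil_ge 1 l -> 0 <= x ->
  (forall y, 0 <= y -> Rabs (g y) <= C) -> Rabs (op l g x) <= weight l * C.
Proof.
  intros Hl Hx H. induction Hl as [|[c d] l Hd Hl IH]; simpl.
  - rewrite Rabs_R0; lra.
  - eapply Rle_trans; [apply Rabs_triang|]. rewrite Rabs_mult.
    assert (Rabs (g (x / d)) <= C) by (apply H; apply (div_bounds 1 d); simpl in *; lra).
    assert (0 <= Rabs c) by apply Rabs_pos. nra.
Qed.

Lemma op_lipschitz (l : list (R * R)) (g : R -> R) (L x y : R) :
  dil_ge 1 l -> 0 <= x <= y ->
  (forall x y, 0 <= x <= y -> Rabs (g y - g x) <= L * (y - x)) ->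
  Rabs (op l g y - op l g x) <= slope l * L * (y - x).
Proof.
  intros Hl Hx H. induction Hl as [|[c d] l Hd Hl IH]; simpl in *.
  - rewrite Rminus_diag, Rabs_R0; lra.
  - replace (c * g (y / d) + op l g y - (c * g (x / d) + op l g x))
      with (c * (g (y / d) - g (x / d)) + (op l g y - op l g x)) by ring.
    eapply Rle_trans; [apply Rabs_triang|]. rewrite Rabs_mult.
    assert (0 < / d) by (apply Rinv_0_lt_compat; lra).
    assert (Rabs (g (y / d) - g (x / d)) <= L * (y / d - x / d)).
    { apply H. unfold Rdiv. nra. }
    assert (0 <= Rabs c) by apply Rabs_pos.
    replace ((Rabs c / d + slope l) * L * (y - x)) with
      (Rabs c * (L * (y / d - x / d)) + slope l * L * (y - x)) by (unfold Rdiv; ring).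
    apply Rplus_le_compat; [apply Rmult_le_compat_l; assumption|assumption].
Qed.

Lemma slope_app (l m : list (R * R)) : slope (l ++ m) = slope l + slope m.
Proof. induction l as [|[c d] l IH]; simpl; [lra|rewrite IH; lra]. Qed.

Lemma slope_scale (c d : R) (l : list (R * R)) :
  slope (scale c d l) = Rabs c / d * slope l.
Proof.
  induction l as [|[c' d'] l IH]; simpl; [lra|]. fold (scale c d l). rewrite IH.
  rewrite Rabs_mult. unfold Rdiv. rewrite Rinv_mult. ring.
Qed.

Lemma slope_pos (l : list (R * R)) : dil_ge 1 l -> 0 <= slope l.
Proof.
  intros Hl. induction Hl as [|[c d] l Hd Hl IH]; simpl in *; [lra|].
  assert (0 <= Rabs c / d) by (apply Rle_mult_inv_pos; [apply Rabs_pos|lra]). lra.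
Qed.

(** * The sieve operator A and its approximate inverse *)

Fixpoint euler (ps : list nat) : list (R * R) :=
  match ps with
  | nil => (1, 1) :: nil
  | p :: ps => mul ((1, 1) :: (-1, INR p) :: nil) (euler ps)
  end.

Lemma dil_ge_euler (ps : list nat) : Forall (fun p => (2 <= p)%nat) ps -> dil_ge 1 (euler ps).
Proof.
  intros H. induction H as [|p ps Hp H IH].
  - apply Forall_cons; [simpl; lra|constructor].
  - apply dil_ge_mul; [|exact IH|lra]. apply le_INR in Hp. simpl in Hp.
    do 2 (apply Forall_cons; [simpl; lra|]); constructor.
Qed.

Fixpoint geom (d : R) (J : nat) : list (R * R) :=
  match J with
  | O => nil
  | S j => (1, d ^ j) :: geom d j
  end.

Lemma dil_ge_geom (d : R) (J : nat) : 1 <= d -> dil_ge 1 (geom d J).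
Proof.
  intros Hd. induction J as [|j IH]; simpl; constructor; [|exact IH].
  apply pow_R1_Rle; assumption.
Qed.

(** The geometric sum telescopes against [1 - D_d]. *)
Lemma op_geom (d : R) (J : nat) (g : R -> R) (x : R) : d <> 0 ->
  op (geom d J) (op ((1, 1) :: (-1, d) :: nil) g) x = g x - g (x / d ^ J).
Proof.
  intros Hd. induction J as [|j IH].
  - simpl. rewrite Rdiv_1_r. lra.
  - cbn [geom op] in *. rewrite IH.
    replace (x / d ^ S j) with (x / d ^ j / d)
      by (simpl; field; split; [apply pow_nonzero|]; assumption).
    rewrite Rdiv_1_r. lra.
Qed.

(* Witness: [S = prod_p (1 + D_p + ... + D_p^(J-1))] with [J] large, for which
   [S * euler ps = prod_p (1 - D_p^J)]. *)
Lemma euler_almost_inverse (ps : list nat) (eps : R) :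
  Forall (fun p => (2 <= p)%nat) ps -> 0 < eps ->
  exists S B : list (R * R),
    dil_ge 1 S /\ dil_ge 2 B /\ slope B <= eps /\
    forall g x, op S (op (euler ps) g) x = g x + op B g x.
Proof.
  intros H. revert eps. induction H as [|p ps Hp H IH]; intros eps Heps.
  - exists ((1, 1) :: nil), nil. repeat split.
    + apply Forall_cons; [simpl; lra|constructor].
    + constructor.
    + simpl; lra.
    + intros g x. simpl. rewrite !Rdiv_1_r. lra.
  - destruct (IH (eps / 2) ltac:(lra)) as (S & B & HS & HB & Hsl & Hop).
    apply le_INR in Hp. simpl in Hp. set (d := INR p) in *.
    (* The new slope will be [slope B + d^(-j) * (1 + slope B)]. With [slope B <= eps / 2], it is
       enough that [d^(-j) * (1 + eps) < eps / 2]. *)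
    destruct (pow_lt_1_zero (/ d)) with (y := eps / 2 / (1 + eps)) as [J HJ].
    { rewrite Rabs_pos_eq; [|left; apply Rinv_0_lt_compat; lra].
      rewrite <- Rinv_1. apply Rinv_lt_contravar; lra. }
    { apply Rdiv_lt_0_compat; lra. }
    (* A positive exponent guarantees [d ^ j >= 2], as the dilations of the new remainder must be at
       least 2. *)
    specialize (HJ (Datatypes.S J) ltac:(lia)). set (j := Datatypes.S J) in *.
    assert (Hdj : 2 <= d ^ j).
    { unfold j. simpl. assert (1 <= d ^ J) by (apply pow_R1_Rle; lra). nra. }
    assert (Hinv : 0 < / d ^ j) by (apply Rinv_0_lt_compat; lra).
    rewrite pow_inv, Rabs_pos_eq in HJ by lra.
    (* The second list expands [(1 + B) (1 - D_(d^j)) - 1]. *)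
    exists (mul (geom d j) S), (B ++ (-1, d ^ j) :: scale (-1) (d ^ j) B).
    repeat split.
    + apply dil_ge_mul; [apply dil_ge_geom; lra|exact HS|lra].
    + apply Forall_app; split; [exact HB|]. apply Forall_cons; [exact Hdj|].
      apply Forall_map. eapply Forall_impl; [|exact HB]. cbn [snd]; intros; nra.
    + rewrite slope_app. cbn [slope]. rewrite slope_scale, (Rabs_left (-1)) by lra.
      assert (/ d ^ j * (1 + eps) < eps / 2).
      { apply Rmult_lt_reg_r with (/ (1 + eps)); [apply Rinv_0_lt_compat; lra|].
        rewrite Rmult_assoc, Rinv_r by lra. rewrite Rmult_1_r. exact HJ. }
      assert (0 <= slope B).
      { apply slope_pos, (dil_ge_weaken 1 2); [exact HB|lra]. }
      unfold Rdiv in *. nra.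
    + intros g x. cbn [euler]. fold d. rewrite op_mul.
      transitivity (op (geom d j) (op ((1, 1) :: (-1, d) :: nil)
        (fun y => 1 * g y + 1 * op B g y)) x).
      * apply op_ext. intros y.
        rewrite (op_ext S _ _ y (op_mul ((1, 1) :: (-1, d) :: nil) (euler ps) g)).
        rewrite op_comm. apply op_ext. intros z. rewrite Hop. lra.
      * rewrite op_geom by lra. rewrite op_app. cbn [op]. rewrite op_scale. lra.
Qed.

(** * The slowly varying target N *)

(* Iterates towards the solution [N] of [N = A (B s) - B N], that is
   [N = A B (1 + B)^-1 s]; since [B] has dilations at least 2, they stabilise on
   bounded sets as soon as [s] vanishes on [0, 1]. *)
Fixpoint neumann (A B : list (R * R)) (s : R -> R) (h : nat) (x : R) : R :=
  match h with
  | O => 0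
  | S h => op (mul A B) s x - op B (neumann A B s h) x
  end.

(** At [x], the iterate number [flr x] is already final: the iterates are stable on [[0, 2^h]] from
    index [h] on, and [x <= 2^(flr x)]. *)
Definition target (A B : list (R * R)) (s : R -> R) (x : R) : R :=
  neumann A B s (flr x) x.

(** [B] looks only at arguments up to [x / 2], so every iteration doubles the interval of vanishing.
    It serves for differences of successive iterates and for the defect in the equation
    [Sg N = B s]. *)
Lemma iterates_vanish (B : list (R * R)) (Y : nat -> R -> R) :
  dil_ge 2 B -> (forall x, 0 <= x <= 1 -> Y 0%nat x = 0) ->
  (forall h x, Y (S h) x = - op B (Y h) x) ->
  forall h x, 0 <= x <= 2 ^ h -> Y h x = 0.
Proof.
  intros HB H0 HS h. induction h as [|h IH]; intros x Hx; [apply H0; simpl in Hx; lra|].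
  rewrite HS, (op_zero_below 2); [lra|lra|exact HB|lra|].
  intros y Hy. apply IH. simpl in Hx. lra.
Qed.

Lemma pow2_flr (x : R) (h : nat) : 0 <= x -> (flr x <= h)%nat -> x <= 2 ^ h.
Proof.
  intros Hx Hh. destruct (flr_spec x Hx) as [_ H].
  apply le_INR in Hh.
  assert (INR h + 1 <= 2 ^ h); [|lra].
  clear. induction h as [|h IH]; [simpl; lra|]. rewrite S_INR. simpl.
  assert (0 <= INR h) by apply pos_INR. lra.
Qed.

Lemma neumann_stable (A B : list (R * R)) (s : R -> R) (x : R) (h : nat) :
  dil_ge 1 A -> dil_ge 2 B -> (forall x, 0 <= x <= 1 -> s x = 0) ->
  0 <= x -> (flr x <= h)%nat ->
  neumann A B s h x = target A B s x.
Proof.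
  intros HA HB Hs Hx Hh. unfold target.
  assert (Hdiff : forall h y, 0 <= y <= 2 ^ h ->
    neumann A B s (S h) y - neumann A B s h y = 0).
  { apply (iterates_vanish B (fun h y => neumann A B s (S h) y - neumann A B s h y) HB).
    - intros y Hy. cbn [neumann].
      rewrite (op_zero_below 2 (mul A B) s), (op_zero_below 2 B); try lra; try assumption.
      + reflexivity.
      + apply dil_ge_mul; [exact HA|exact HB|lra].
      + intros z Hz. apply Hs. lra.
    - intros k y. cbn [neumann].
      rewrite (op_ext B
        (fun y => op (mul A B) s y - op B (neumann A B s k) y - neumann A B s k y)
        (fun y => 1 * neumann A B s (S k) y + (-1) * neumann A B s k y))
        by (intros; simpl; lra).
      rewrite op_lin. cbn [neumann]. lra. }
  induction Hh as [|h Hh IH]; [reflexivity|].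
  rewrite <- IH. assert (H := Hdiff h x (conj Hx (pow2_flr x h Hx Hh))). lra.
Qed.

(** Write [N_h] for the iterates. From [Sg A = 1 + B] follows
    [Sg N_(h+1) - B s = - B (Sg N_h - B s)], so the defect vanishes on growing intervals. *)
Lemma op_target (A B Sg : list (R * R)) (s : R -> R) :
  dil_ge 1 A -> dil_ge 2 B -> dil_ge 1 Sg -> (forall x, 0 <= x <= 1 -> s x = 0) ->
  (forall g x, op Sg (op A g) x = g x + op B g x) ->
  forall x, 0 <= x -> op Sg (target A B s) x = op B s x.
Proof.
  intros HA HB HSg Hs Hop x Hx.
  assert (H : forall h y, 0 <= y <= 2 ^ h ->
    op Sg (neumann A B s h) y - op B s y = 0).
  { apply (iterates_vanish B (fun h y => op Sg (neumann A B s h) y - op B s y) HB).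
    - intros y Hy. rewrite (op_zero_below 1 Sg) by (simpl; auto; lra).
      rewrite (op_zero_below 2 B); try lra; [assumption|].
      intros z Hz. apply Hs. lra.
    - intros k y.
      rewrite (op_ext Sg (neumann A B s (S k))
        (fun y => 1 * op A (op B s) y + (-1) * op B (neumann A B s k) y))
        by (intros; cbn [neumann]; rewrite op_mul; lra).
      rewrite op_lin, Hop, (op_comm Sg B).
      rewrite (op_ext B (fun y => op Sg (neumann A B s k) y - op B s y)
        (fun y => 1 * op Sg (neumann A B s k) y + (-1) * op B s y)) by (intros; lra).
      rewrite op_lin. lra. }
  (* [Sg] evaluates the target at several points [y <= x], each with its own iterate; stability
     replaces them all by iterate number [flr x]. *)
  rewrite (op_ext_below 1 Sg (target A B s) (neumann A B s (flr x))); try lra; auto.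
  - assert (H1 := H (flr x) x (conj Hx (pow2_flr x _ Hx (le_n _)))). lra.
  - intros y Hy. symmetry. apply neumann_stable; auto; [lra|]. apply flr_le; lra.
Qed.

(** The Lipschitz constant [eta] passes from one iterate to the next: [A B s] contributes
    [slope A * slope B] and the previous iterate [slope B * eta]. As [eta <= 1], their sum is at
    most [slope B * (slope A + 1) <= eta]. *)
Lemma target_lipschitz (A B : list (R * R)) (s : R -> R) (eta : R) :
  dil_ge 1 A -> dil_ge 2 B -> (forall x, 0 <= x <= 1 -> s x = 0) ->
  (forall x y, 0 <= x <= y -> Rabs (s y - s x) <= 1 * (y - x)) ->
  0 < eta <= 1 -> slope B <= eta / (slope A + 1) ->
  forall x y, 0 <= x <= y -> Rabs (target A B s y - target A B s x) <= eta * (y - x).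
Proof.
  intros HA HB Hs Hlip Heta Hsl.
  assert (HB1 : dil_ge 1 B) by (apply (dil_ge_weaken 1 2); [exact HB|lra]).
  assert (HA0 := slope_pos A HA). assert (HB0 := slope_pos B HB1).
  assert (Hb : slope A * slope B + slope B * eta <= eta).
  { assert (slope B * (slope A + 1) <= eta).
    { replace eta with (eta / (slope A + 1) * (slope A + 1)) by (field; lra).
      apply Rmult_le_compat_r; lra. }
    nra. }
  assert (H : forall h x y, 0 <= x <= y ->
    Rabs (neumann A B s h y - neumann A B s h x) <= eta * (y - x)).
  { induction h as [|h IH]; intros x y Hxy; cbn [neumann].
    - rewrite Rminus_diag, Rabs_R0. nra.
    - rewrite !op_mul.
      assert (H1 : Rabs (op A (op B s) y - op A (op B s) x)
                   <= slope A * (slope B * 1) * (y - x)).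
      { apply op_lipschitz; auto. intros; apply op_lipschitz; auto. }
      assert (H2 := op_lipschitz B (neumann A B s h) eta x y HB1 Hxy IH).
      apply Rabs_le. apply Rabs_le_inv in H1, H2. nra. }
  intros x y Hxy. rewrite <- (neumann_stable A B s x (flr y)); auto; [|lra|apply flr_le; lra].
  apply H; assumption.
Qed.

Lemma target_ext (A B : list (R * R)) (s t : R -> R) (x : R) :
  dil_ge 1 A -> dil_ge 2 B -> 0 <= x ->
  (forall y, 0 <= y <= x / 2 -> s y = t y) -> target A B s x = target A B t x.
Proof.
  intros HA HB Hx H. unfold target. generalize (flr x) as h. intros h.
  revert x Hx H. induction h as [|h IH]; intros x Hx H; cbn [neumann]; [reflexivity|].
  f_equal.
  - apply (op_ext_below 2); auto; try lra. apply dil_ge_mul; auto; lra.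
  - apply (op_ext_below 2); auto; try lra. intros y Hy. apply IH; [lra|].
    intros z Hz. apply H. lra.
Qed.

(** * Greedy choice of the free signs *)

(** A free step taken with error at most [3 - eta] brings the error down to 2, since the sign points
    towards the target. Free steps recur with period [Q], and in one period the target drifts by at
    most [eta * Q <= 1]. *)
Lemma greedy_tracking (a N : nat -> R) (free : nat -> bool) (eta : R) (Q : nat) :
  (1 <= Q)%nat -> eta * INR Q <= 1 -> 0 <= eta -> N O = 0 ->
  (forall n, Rabs (N (S n) - N n) <= eta) ->
  (forall n, a (S n) = if free (S n) then
      if Rle_dec (rsum a n) (N (S n)) then 1 else -1 else 0) ->
  (forall k, free (S (k * Q)) = true) ->
  forall n, Rabs (rsum a n - N n) <= 3.
Proof.
  intros HQ HeQ He HN0 HN Ha Hfree.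
  assert (Hstep : forall n c, 2 <= c -> Rabs (rsum a n - N n) <= c ->
    Rabs (rsum a (S n) - N (S n)) <= c + eta).
  { intros n c Hc H. cbn [rsum]. rewrite Ha. specialize (HN n).
    apply Rabs_le_inv in H, HN. apply Rabs_le.
    destruct (free (S n)); [destruct Rle_dec|]; lra. }
  assert (Hstep' : forall n, free (S n) = true -> Rabs (rsum a n - N n) <= 3 - eta ->
    Rabs (rsum a (S n) - N (S n)) <= 2).
  { intros n Hf H. cbn [rsum]. rewrite Ha, Hf. specialize (HN n).
    apply Rabs_le_inv in H, HN. apply Rabs_le. destruct Rle_dec; lra. }
  assert (He1 : eta <= 1) by (apply le_INR in HQ; simpl in HQ; nra).
  assert (Hrow : forall n0, Rabs (rsum a n0 - N n0) <= 2 ->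
    forall r, Rabs (rsum a (n0 + r) - N (n0 + r)%nat) <= 2 + eta * INR r).
  { intros n0 H0 r. induction r as [|r IH].
    - rewrite Nat.add_0_r. simpl. lra.
    - rewrite Nat.add_succ_r, S_INR.
      assert (0 <= eta * INR r) by (apply Rmult_le_pos; [assumption|apply pos_INR]).
      replace (2 + eta * (INR r + 1)) with (2 + eta * INR r + eta) by ring.
      apply Hstep; [lra|exact IH]. }
  assert (Hblock : forall k, Rabs (rsum a (S (k * Q)) - N (S (k * Q))) <= 2).
  { induction k as [|k IH].
    - apply Hstep'; [apply (Hfree O)|]. simpl. rewrite HN0, Rminus_diag, Rabs_R0. lra.
    - apply Hstep'; [apply Hfree|].
      (* Only [Q - 1] steps separate one guaranteed free position from the point just before the
         next, so the error there is at most [2 + eta * (Q - 1) <= 3 - eta]. *)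
      replace (S k * Q)%nat with (S (k * Q) + (Q - 1))%nat by (simpl; lia).
      eapply Rle_trans; [apply Hrow, IH|].
      rewrite minus_INR by assumption. simpl (INR 1). lra. }
  intros [|n].
  - simpl. rewrite HN0, Rminus_diag, Rabs_R0. lra.
  - assert (H1 := Nat.div_mod_eq n Q).
    assert (H2 := Nat.mod_upper_bound n Q ltac:(lia)).
    replace (S n) with (S (n / Q * Q) + n mod Q)%nat by lia.
    eapply Rle_trans; [apply Hrow, Hblock|].
    apply Nat.lt_le_incl, le_INR in H2.
    assert (eta * INR (n mod Q) <= eta * INR Q) by (apply Rmult_le_compat_l; assumption).
    lra.
Qed.

(** Iterate [Phi] from a constant function. By causality the value at [n] is settled after [n + 1]
    iterations, so the diagonal is a fixed point. *)
Lemma strong_recursion (X : Type) (Phi : (nat -> X) -> nat -> X) (x0 : X) :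
  (forall f g n, (forall m, (m < n)%nat -> f m = g m) -> Phi f n = Phi g n) ->
  exists f, forall n, f n = Phi f n.
Proof.
  intros H. set (it := fun k => Nat.iter k Phi (fun _ => x0)).
  assert (Hst : forall n j k, (n < j)%nat -> (n < k)%nat -> it j n = it k n).
  { induction n as [n IH] using (well_founded_induction lt_wf).
    intros [|j] [|k] Hj Hk; try lia. apply H. intros m Hm. apply IH; lia. }
  exists (fun n => it (S n) n). intros n.
  change (it (S n) n) with (Phi (it n) n). apply H. intros m Hm. apply Hst; lia.
Qed.

(** * Sieving by the primes of P *)

Definition coprime_to (ps : list nat) (n : nat) : bool :=
  forallb (fun p => negb (n mod p =? 0)%nat) ps.

Definition restrict (ps : list nat) (f : nat -> Z) (n : nat) : R :=
  if coprime_to ps n then IZR (f n) else 0.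

Definition nprime (p : nat) : Prop := prime (Z.of_nat p).

Lemma nprime_ge2 (p : nat) : nprime p -> (2 <= p)%nat.
Proof. intros H. apply prime_ge_2 in H. lia. Qed.

Lemma mod_dvd (n p : nat) : (n mod p = 0)%nat <-> Nat.divide p n.
Proof. apply Nat.Lcm0.mod_divide. Qed.

Lemma Z_of_nat_divide (p n : nat) : (Z.of_nat p | Z.of_nat n)%Z <-> Nat.divide p n.
Proof.
  split; intros [k Hk].
  - exists (Z.to_nat k). destruct (Nat.eq_dec n 0) as [->|Hn]; [|nia].
    destruct (Nat.eq_dec p 0) as [->|Hp]; [lia|]. nia.
  - exists (Z.of_nat k). lia.
Qed.

Lemma nprime_mult (p m n : nat) : nprime p -> Nat.divide p (m * n) ->
  Nat.divide p m \/ Nat.divide p n.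
Proof.
  intros Hp H. rewrite <- !Z_of_nat_divide, Nat2Z.inj_mul in *. apply prime_mult; assumption.
Qed.

Lemma nprime_divide_eq (p q : nat) : nprime p -> nprime q -> Nat.divide p q -> p = q.
Proof.
  intros Hp Hq H. apply Z_of_nat_divide, prime_div_prime in H; auto. lia.
Qed.

Lemma mod_mul_prime (p q n : nat) : nprime p -> nprime q -> p <> q ->
  ((p * n) mod q =? 0)%nat = (n mod q =? 0)%nat.
Proof.
  intros Hp Hq Hpq.
  destruct (Nat.eqb_spec ((p * n) mod q) 0) as [H|H], (Nat.eqb_spec (n mod q) 0) as [H'|H'];
    try reflexivity; exfalso; rewrite !mod_dvd in *.
  - apply nprime_mult in H; [|assumption]. destruct H as [H|H]; [|contradiction].
    apply nprime_divide_eq in H; auto.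
  - apply H. apply Nat.divide_mul_r. assumption.
Qed.

Lemma coprime_to_mul (ps : list nat) (p n : nat) : Forall nprime ps -> nprime p ->
  ~ In p ps -> coprime_to ps (p * n) = coprime_to ps n.
Proof.
  intros Hps Hp. unfold coprime_to. induction Hps as [|q ps Hq Hps IH]; intros Hin; [reflexivity|].
  cbn [forallb]. rewrite (mod_mul_prime p q); [|assumption..|intros ->; apply Hin; left; reflexivity].
  rewrite IH; [reflexivity|]. intros H; apply Hin; right; assumption.
Qed.

(** This is [M = A F]. Each factor [1 - D_p] deletes the multiples of [p]: because
    [f (p * q) = f q], the dilated sum is exactly the part of the sum carried by those multiples. *)
Lemma op_euler_step_sum (ps : list nat) (f : nat -> Z) :
  Forall nprime ps -> NoDup ps ->
  (forall p n, In p ps -> (1 <= n)%nat -> f (p * n)%nat = f n) ->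
  forall x, 0 <= x ->
  op (euler ps) (step_sum (fun n => IZR (f n))) x = step_sum (restrict ps f) x.
Proof.
  intros Hps Hnd Hf. induction ps as [|p ps IH]; intros x Hx.
  - cbn [euler op]. rewrite Rdiv_1_r. unfold restrict. cbn [coprime_to forallb]. lra.
  - inversion Hps as [|? ? Hp Hps']; subst. inversion Hnd as [|? ? Hin Hnd']; subst.
    assert (Hp2 := nprime_ge2 p Hp).
    assert (Hd : 1 <= INR p) by (apply (le_INR 1); lia).
    assert (Hf' : forall q n, In q ps -> (1 <= n)%nat -> f (q * n)%nat = f n)
      by (intros; apply Hf; [right|]; assumption).
    specialize (IH Hps' Hnd' Hf').
    cbn [euler]. rewrite op_mul. cbn [op]. rewrite Rdiv_1_r, !IH; [|apply (div_bounds 1); lra|assumption].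
    unfold step_sum. rewrite flr_div by (assumption || lia). rewrite rsum_dilate by lia.
    rewrite Rplus_0_r, Rmult_1_l, <- (Ropp_mult_distr_l 1), Rmult_1_l.
    change (?u + - ?v) with (u - v). rewrite <- rsum_minus. apply rsum_ext. intros m Hm.
    unfold restrict. unfold coprime_to at 3. cbn [forallb]. fold (coprime_to ps m).
    destruct (Nat.eqb_spec (m mod p) 0) as [H|H]; simpl.
    + assert (Hm' := Nat.div_mod_eq m p). rewrite H, Nat.add_0_r in Hm'.
      set (q := (m / p)%nat) in *. clearbody q. subst m.
      rewrite coprime_to_mul by assumption.
      destruct coprime_to; [|lra].
      rewrite Hf; [lra|left; reflexivity|].
      destruct q; lia.
    + destruct coprime_to; lra.
Qed.

(** * Construction of f *)

Definition divisor_in (ps : list nat) (n : nat) : option nat :=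
  find (fun p => (n mod p =? 0)%nat) ps.

Lemma divisor_in_None (ps : list nat) (n : nat) :
  divisor_in ps n = None <-> coprime_to ps n = true.
Proof.
  unfold divisor_in, coprime_to. induction ps as [|p ps IH]; simpl; [tauto|].
  destruct (n mod p =? 0)%nat; simpl; [split; discriminate|exact IH].
Qed.

Lemma divisor_in_Some (ps : list nat) (n p : nat) :
  divisor_in ps n = Some p -> In p ps /\ n = (p * (n / p))%nat.
Proof.
  intros H. apply find_some in H. destruct H as [Hin H]. split; [exact Hin|].
  apply Nat.eqb_eq in H. assert (H1 := Nat.div_mod_eq n p). lia.
Qed.

(** One step of the recursion whose fixed point is [f]. A multiple of some prime in [ps] inherits
    its sign through the first such prime; at a free [n] the sign pushes the sum up to [n - 1]
    towards the target at [n]. The value 1 at 0 makes [f] a sign everywhere. *)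
Definition build (A B : list (R * R)) (ps : list nat) (f : nat -> Z) (n : nat) : Z :=
  if (n =? 0)%nat then 1%Z else
  match divisor_in ps n with
  | Some p => f (n / p)%nat
  | None =>
      if Rle_dec (rsum (restrict ps f) (pred n))
                 (target A B (ramp_sum (fun m => IZR (f m))) (INR n))
      then 1%Z else (-1)%Z
  end.

Lemma build_causal (A B : list (R * R)) (ps : list nat) (f g : nat -> Z) (n : nat) :
  Forall nprime ps -> dil_ge 1 A -> dil_ge 2 B ->
  (forall m, (m < n)%nat -> f m = g m) -> build A B ps f n = build A B ps g n.
Proof.
  intros Hps HA HB H. unfold build. destruct (Nat.eqb_spec n 0) as [Hn|Hn]; [reflexivity|].
  assert (1 <= INR n) by (apply (le_INR 1); lia).
  destruct (divisor_in ps n) as [p|] eqn:E.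
  - apply divisor_in_Some in E. destruct E as [Hin E].
    rewrite Forall_forall in Hps. assert (Hp := nprime_ge2 p (Hps p Hin)).
    apply H. apply Nat.div_lt; lia.
  - rewrite (rsum_ext (restrict ps f) (restrict ps g)).
    2:{ intros m Hm. unfold restrict. rewrite H by lia. reflexivity. }
    rewrite (target_ext A B (ramp_sum (fun m => IZR (f m))) (ramp_sum (fun m => IZR (g m))));
      [reflexivity|assumption|assumption|lra|].
    intros y Hy. apply ramp_sum_ext; [lra|]. intros m Hm. rewrite H; [reflexivity|].
    apply INR_lt. lra.
Qed.

(** The choice of the first prime is immaterial. If [q] other than [p] is selected for [p * n], then
    [n = k * q], and induction at [k] gives [f (p * n) = f (p * k) = f k = f n]. *)
Lemma build_invariant (A B : list (R * R)) (ps : list nat) (f : nat -> Z) :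
  Forall nprime ps -> (forall n, f n = build A B ps f n) ->
  forall n p, In p ps -> (1 <= n)%nat -> f (p * n)%nat = f n.
Proof.
  intros Hps Hf. assert (Hps' := Hps). rewrite Forall_forall in Hps'.
  assert (Hunf : forall n, (1 <= n)%nat -> forall p, divisor_in ps n = Some p ->
    f n = f (n / p)%nat).
  { intros n Hn p E. rewrite Hf at 1. unfold build.
    destruct (Nat.eqb_spec n 0); [lia|]. rewrite E. reflexivity. }
  induction n as [n IH] using (well_founded_induction lt_wf). intros p Hp Hn.
  assert (Hp2 := nprime_ge2 p (Hps' p Hp)).
  destruct (divisor_in ps (p * n)) as [q|] eqn:E.
  - rewrite (Hunf (p * n)%nat ltac:(nia) q E). apply divisor_in_Some in E.
    destruct E as [Hq E]. assert (Hq2 := nprime_ge2 q (Hps' q Hq)).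
    destruct (Nat.eq_dec p q) as [<-|Hpq].
    + rewrite Nat.mul_comm, Nat.div_mul by lia. reflexivity.
    + assert (Hd : Nat.divide q (p * n)) by (exists (p * n / q)%nat; lia).
      apply nprime_mult in Hd; [|auto]. destruct Hd as [Hd|[k Hk]].
      { apply nprime_divide_eq in Hd; auto. congruence. }
      assert (1 <= k)%nat by (destruct k; lia).
      assert (k < n)%nat by nia.
      rewrite Hk, Nat.mul_assoc, Nat.div_mul, (IH k) by (lia || assumption).
      rewrite Nat.mul_comm, (IH k) by assumption. reflexivity.
  - exfalso. apply (find_none _ _ E) in Hp. apply Nat.eqb_neq in Hp. apply Hp.
    apply mod_dvd. exists n. lia.
Qed.

Lemma build_sign (A B : list (R * R)) (ps : list nat) (f : nat -> Z) :
  Forall nprime ps -> (forall n, f n = build A B ps f n) ->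
  forall n, f n = 1%Z \/ f n = (-1)%Z.
Proof.
  intros Hps Hf. rewrite Forall_forall in Hps.
  induction n as [n IH] using (well_founded_induction lt_wf).
  rewrite Hf. unfold build. destruct (Nat.eqb_spec n 0); [auto|].
  destruct (divisor_in ps n) as [p|] eqn:E.
  - apply divisor_in_Some in E. destruct E as [Hin E].
    assert (Hp := nprime_ge2 p (Hps p Hin)). apply IH. apply Nat.div_lt; lia.
  - destruct Rle_dec; auto.
Qed.

(** Supplies the periodic free positions [S (k * Q)], with [Q] the product of the primes. *)
Lemma coprime_to_succ_multiple (ps : list nat) (n : nat) :
  Forall nprime ps -> (forall p, In p ps -> Nat.divide p n) -> coprime_to ps (S n) = true.
Proof.
  intros Hps H. apply forallb_forall. intros p Hp.
  rewrite Forall_forall in Hps. assert (Hp2 := nprime_ge2 p (Hps p Hp)).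
  destruct (Nat.eqb_spec (S n mod p) 0) as [E|E]; [|reflexivity].
  apply mod_dvd in E. specialize (H p Hp).
  replace (S n) with (1 + n)%nat in E by lia. rewrite Nat.add_comm in E.
  apply (Nat.divide_add_cancel_r p n 1 H), Nat.divide_1_r in E. lia.
Qed.

Lemma divide_product (ps : list nat) (p : nat) :
  In p ps -> Nat.divide p (fold_right Nat.mul 1%nat ps).
Proof.
  induction ps as [|q ps IH]; simpl; [tauto|]. intros [->|H].
  - apply Nat.divide_factor_l.
  - apply Nat.divide_mul_r. auto.
Qed.

Lemma product_pos (ps : list nat) :
  Forall nprime ps -> (1 <= fold_right Nat.mul 1%nat ps)%nat.
Proof.
  induction 1 as [|p ps Hp H IH]; simpl; [lia|]. assert (Hp2 := nprime_ge2 p Hp). nia.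
Qed.

Lemma IZR_psum (f : nat -> Z) (n : nat) : IZR (psum f n) = rsum (fun m => IZR (f m)) n.
Proof. induction n as [|n IH]; simpl; [reflexivity|rewrite plus_IZR, IH; reflexivity]. Qed.

(** * Boundedness of the partial sums *)

Lemma bounded_of_primes (ps : list nat) : Forall nprime ps -> NoDup ps ->
  exists f : nat -> Z,
    (forall n, f n = 1%Z \/ f n = (-1)%Z) /\
    (forall n p, In p ps -> (1 <= n)%nat -> f (p * n)%nat = f n) /\
    exists C : R, forall N, Rabs (IZR (psum f N)) <= C.
Proof.
  intros Hps Hnd.
  assert (Hps2 : Forall (fun p => (2 <= p)%nat) ps)
    by (eapply Forall_impl; [|exact Hps]; apply nprime_ge2).
  set (Q := fold_right Nat.mul 1%nat ps). assert (HQ := product_pos ps Hps). fold Q in HQ.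
  assert (HQ1 : 1 <= INR Q) by (apply (le_INR 1); lia).
  (* With this slope the target drifts by at most 1 over a period [Q] of free positions. *)
  set (eta := / INR Q).
  assert (Heta : 0 < eta <= 1).
  { split; [apply Rinv_0_lt_compat; lra|]. rewrite <- Rinv_1. apply Rinv_le_contravar; lra. }
  set (A := euler ps). assert (HA : dil_ge 1 A) by (apply dil_ge_euler; assumption).
  assert (HA0 := slope_pos A HA).
  destruct (euler_almost_inverse ps (eta / (slope A + 1)) Hps2) as (Sg & B & HS & HB & Hsl & Hop).
  { apply Rdiv_lt_0_compat; lra. }
  fold A in Hop.
  assert (HB1 : dil_ge 1 B) by (apply (dil_ge_weaken 1 2); [exact HB|lra]).
  destruct (strong_recursion Z (build A B ps) 0%Z) as [f Hf].
  { intros; apply build_causal; assumption. }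
  assert (Hsign := build_sign A B ps f Hps Hf).
  assert (Hinv := build_invariant A B ps f Hps Hf).
  exists f. split; [exact Hsign|]. split; [exact Hinv|].
  set (a := fun n => IZR (f n)).
  assert (Ha : forall n, Rabs (a n) <= 1).
  { intros n. unfold a. destruct (Hsign n) as [-> | ->]; apply Rabs_le; lra. }
  set (s := ramp_sum a). set (N := target A B s).
  assert (Hs : forall x, 0 <= x <= 1 -> s x = 0) by apply ramp_sum_small.
  assert (HN : forall x y, 0 <= x <= y -> Rabs (N y - N x) <= eta * (y - x)).
  { apply target_lipschitz; auto. intros x y Hxy. rewrite Rmult_1_l.
    apply ramp_sum_lipschitz; assumption. }
  assert (Htrack : forall n, Rabs (rsum (restrict ps f) n - N (INR n)) <= 3).
  { apply (greedy_tracking _ (fun n => N (INR n)) (coprime_to ps) eta Q); try lra; try assumption.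
    - unfold eta. rewrite Rinv_l; lra.
    - unfold N, target. simpl INR. rewrite (flr_unique 0 0) by (simpl; lra). reflexivity.
    - intros n. eapply Rle_trans; [apply HN|]; rewrite S_INR; [assert (H := pos_INR n); lra|lra].
    - intros n. unfold restrict at 1. destruct (coprime_to ps (S n)) eqn:E; [|reflexivity].
      apply divisor_in_None in E. rewrite Hf. unfold build. rewrite E. cbn [Nat.eqb Nat.pred].
      fold a. fold s. fold N. destruct Rle_dec; reflexivity.
    - intros k. apply coprime_to_succ_multiple; [assumption|]. intros p Hp.
      apply Nat.divide_mul_r. apply divide_product; assumption. }
  (* The tracking error 3 at integers, plus at most [eta <= 1] for the drift of [N] from [flr x] to
     [x]. *)
  assert (Herr : forall x, 0 <= x -> Rabs (op A (step_sum a) x - N x) <= 4).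
  { intros x Hx. unfold A, a. rewrite op_euler_step_sum; auto.
    unfold step_sum. specialize (Htrack (flr x)). destruct (flr_spec x Hx) as [H1 H2].
    assert (H3 := HN (INR (flr x)) x (conj (pos_INR _) H1)).
    apply Rabs_le_inv in Htrack, H3. apply Rabs_le. nra. }
  exists (weight Sg * 4 + weight B * 1). intros n. rewrite IZR_psum. fold a.
  replace (rsum a n) with (step_sum a (INR n)) by (unfold step_sum; rewrite flr_INR; reflexivity).
  assert (Hn := pos_INR n).
  (* [F = S (A F - N) + B (s - F)], because [S A = 1 + B] and [S N = B s] *)
  replace (step_sum a (INR n)) with
    (op Sg (fun y => op A (step_sum a) y - N y) (INR n) +
     op B (fun y => s y - step_sum a y) (INR n)).
  - eapply Rle_trans; [apply Rabs_triang|]. apply Rplus_le_compat.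
    + apply op_bounded; assumption.
    + apply op_bounded; try assumption. intros; apply ramp_sum_close; assumption.
  - rewrite (op_ext Sg _ (fun y => 1 * op A (step_sum a) y + (-1) * N y)) by (intros; lra).
    rewrite (op_ext B _ (fun y => 1 * s y + (-1) * step_sum a y)) by (intros; lra).
    rewrite !op_lin, Hop. unfold N. rewrite op_target by assumption. lra.
Qed.

Open Scope Z_scope.

Theorem theorem1 (P : list Z) (HP : forall p, In p P -> prime p) :
  exists f : nat -> Z,
    (forall n : nat, (1 <= n)%nat -> f n = 1 \/ f n = -1) /\
    P_multiplicative P f /\
    exists C : Z, forall N : nat, (1 <= N)%nat -> Z.abs (psum f N) <= C.
Proof.
  (* Repetitions in [P] must go, since a repeated factor [1 - D_p] would spoil the sieve
     identity. *)
  set (ps := nodup Nat.eq_dec (map Z.to_nat P)).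
  assert (Hin : forall p, In p ps <-> In (Z.of_nat p) P).
  { intros p. unfold ps. rewrite nodup_In, in_map_iff. split.
    - intros (q & <- & Hq). assert (H := prime_ge_2 q (HP q Hq)).
      rewrite Z2Nat.id by lia. exact Hq.
    - intros H. exists (Z.of_nat p). rewrite Nat2Z.id. auto. }
  destruct (bounded_of_primes ps) as (f & Hsign & Hinv & C & HC).
  - apply Forall_forall. intros p Hp. apply HP, Hin, Hp.
  - apply NoDup_nodup.
  - (* The factor [f 1] normalises the value at 1. *)
    exists (fun n => f 1%nat * f n)%Z. split; [|split].
    + intros n _. destruct (Hsign 1%nat) as [-> | ->], (Hsign n) as [-> | ->]; auto.
    + intros p n Hp Hn. apply Hin in Hp. rewrite Hinv by assumption.
      (* Since [f p = f 1], the new value at [p] is [f 1 * f 1 = 1], which turns invariance into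
         multiplicativity. *)
      rewrite <- (Nat.mul_1_r p), (Hinv 1%nat) by auto.
      destruct (Hsign 1%nat) as [-> | ->]; lia.
    + exists (up C). intros N _.
      assert (Hsum : psum (fun n => f 1%nat * f n) N = f 1%nat * psum f N).
      { clear. induction N as [|N IH]; simpl; [lia|rewrite IH; lia]. }
      assert (Habs : Z.abs (psum (fun n => f 1%nat * f n) N) = Z.abs (psum f N)).
      { rewrite Hsum. destruct (Hsign 1%nat) as [-> | ->]; lia. }
      rewrite Habs. apply le_IZR. rewrite abs_IZR.
      destruct (archimed C). specialize (HC N). lra.
Qed.
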